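(* Let $S(\mathbf{G},\mathbf{\Sigma})$ be a constrained switching system with $\mathbf{\Sigma}\subset\mathbb{R}^{n\times n}$, and let $d\ge1$ be an integer. Let $S^{[d]}(\mathbf{G},\mathbf{\Sigma})$ be the constrained switching system on the same automaton $\mathbf{G}$ with matrix set $\mathbf{\Sigma}^{[d]}=\{A^{[d]}:A\in\mathbf{\Sigma}\}$ (same labels). Then $$\hat\rho(S)\le\gamma_*(S^{[d]})^{1/d}\le C(n+d-1,d)^{1/(2d)}\,\hat\rho(S),$$ where $C(k,\ell)=\binom{k}{\ell}$.
   Context: An automaton $\mathbf{G}(V,E)$ is a strongly connected directed graph with finite node set $V$ and finite edge set $E$ of labelled edges $(v,w,\sigma)$, $\sigma$ indexing a matrix $A_\sigma$. A label sequence is accepted by $\mathbf{G}$ if it is the succession of labels along some path of $\mathbf{G}$ (no prescribed initial/final node). The constrained switching system $S(\mathbf{G},\mathbf{\Sigma})$ is $x_{t+1}=A_{\sigma(t)}x_t$ with accepted switching sequences; its CJSR is $\hat\rho(S)=\lim_{t\to\infty}\max\{\|A_{\sigma(t-1)}\cdots A_{\sigma(0)}\|^{1/t} : \sigma(0),\dots,\sigma(t-1)\text{ accepted}\}$. The $[d]$-lift: for $x\in\mathbb{R}^n$, $x^{[d]}\in\mathbb{R}^{C(n+d-1,d)}$ is the vector with entries $\sqrt{\binom{d}{\alpha}}\,x^\alpha$ indexed by multi-indices $\alpha\in\mathbb{N}^n$ with $|\alpha|=d$ (multinomial coefficients), so that $|x^{[d]}|=|x|^d$ for Euclidean norms. For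 $A\in\mathbb{R}^{n\times n}$, $A^{[d]}$ is the unique $C(n+d-1,d)\times C(n+d-1,d)$ matrix with $A^{[d]}x^{[d]}=(Ax)^{[d]}$ for all $x$. For a constrained switching system $S'$ on automaton $(V',E')$ with matrices in $\mathbb{R}^{m\times m}$, $\gamma_*(S')$ is the infimum of $\gamma$ such that there exist symmetric $Q_v\succ0$ ($v\in V'$) with $\gamma^2Q_v-A_\sigma^\top Q_wA_\sigma\succeq0$ for all $(v,w,\sigma)\in E'$. *)

(* Defs.v *)
From HB Require Import structures.
From mathcomp Require Import all_boot all_order all_algebra.
From mathcomp Require Import all_classical all_reals all_analysis.
From Stdlib Require Import ClassicalEpsilon.

Set Implicit Arguments.
Unset Strict Implicit.
Unset Printing Implicit Defensive.

Import Order.TTheory GRing.Theory Num.Theory.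
Import numFieldNormedType.Exports.
Local Open Scope ring_scope.

Definition edge_rel (V I : finType) (E : {set V * V * I}) : rel V :=
  fun v w => [exists s : I, (v, w, s) \in E].

Definition strongly_connected (V I : finType) (E : {set V * V * I}) : Prop :=
  forall v w : V, connect (edge_rel E) v w.

Definition accepted (V I : finType) (E : {set V * V * I}) (s : seq I) : bool :=
  [exists p : (size s).-tuple (V * V * I),
     [&& all (fun e => e \in E) p,
         sorted (fun e f : V * V * I => e.1.2 == f.1.1) p &
         map (fun e : V * V * I => e.2) p == s]].

(* product A_{s(t-1)} ... A_{s(0)} for s = [:: s(0); ...; s(t-1)] *)
Definition prodmx (R : pzRingType) (I : Type) (m : nat) (A : I -> 'M[R]_m)
  (s : seq I) : 'M[R]_m :=
  foldr (fun i M => M *m A i) 1%:M s.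

(* Matrix norm used in the CJSR (Frobenius; the CJSR does not depend on
   the choice of norm). *)
Definition mxnorm (R : realType) (m : nat) (M : 'M[R]_m) : R :=
  Num.sqrt (\sum_(i < m) \sum_(j < m) M i j ^+ 2).

(* t-th term (t >= 1, written t.+1) of the sequence whose limit is the CJSR *)
Definition cjsr_seq (R : realType) (V I : finType) (E : {set V * V * I})
  (m : nat) (A : I -> 'M[R]_m) (t : nat) : R :=
  \big[Num.max/0]_(s : (t.+1).-tuple I | accepted E s)
     (mxnorm (prodmx A s) `^ ((t.+1)%:R^-1)).

Definition cjsr (R : realType) (V I : finType) (E : {set V * V * I})
  (m : nat) (A : I -> 'M[R]_m) : R :=
  limn (cjsr_seq E A).

Definition posdef (R : realType) (m : nat) (Q : 'M[R]_m) : Prop :=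
  Q^T = Q /\ forall x : 'cV[R]_m, x != 0 -> 0 < (x^T *m Q *m x) 0 0.

Definition psd (R : realType) (m : nat) (Q : 'M[R]_m) : Prop :=
  Q^T = Q /\ forall x : 'cV[R]_m, 0 <= (x^T *m Q *m x) 0 0.

Definition gamma_star (R : realType) (V I : finType) (E : {set V * V * I})
  (m : nat) (A : I -> 'M[R]_m) : R :=
  inf [set g : R | 0 <= g /\
        exists Q : V -> 'M[R]_m,
          (forall v, posdef (Q v)) /\
          (forall v w s, (v, w, s) \in E ->
             psd (g ^+ 2 *: Q v - (A s)^T *m Q w *m A s))].

Definition multi_index (n d : nat) :=
  {a : {ffun 'I_n -> 'I_d.+1} | \sum_(i < n) (a i : nat) == d}.

Definition multinom (R : realType) (n d : nat) (a : multi_index n d) : R :=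
  (d`!)%:R / (\prod_(i < n) ((val a i : nat)`!))%:R.

(* x^[d], indexed by 'I_#|multi_index n d| via the enumeration of
   multi-indices; #|multi_index n d| = C(n+d-1, d). *)
Definition liftv (R : realType) (n d : nat) (x : 'cV[R]_n)
  : 'cV[R]_#|{: multi_index n d}| :=
  \col_k (let a := enum_val k in
          Num.sqrt (multinom R a) * \prod_(i < n) x i 0 ^+ (val a i : nat)).

(* A^[d] : the unique matrix with A^[d] x^[d] = (A x)^[d] for all x. *)
Definition liftmx (R : realType) (n d : nat) (A : 'M[R]_n)
  : 'M[R]_#|{: multi_index n d}| :=
  epsilon (inhabits 0)
    (fun B : 'M[R]_#|{: multi_index n d}| =>
       forall x : 'cV[R]_n, B *m liftv d x = liftv d (A *m x)).

Definition liftsys (R : realType) (I : Type) (n d : nat) (A : I -> 'M[R]_n)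
  : I -> 'M[R]_#|{: multi_index n d}| :=
  fun s => liftmx d (A s).

(* Main.v *)
(** Let rho be the CJSR, m = C(n+d-1,d), and identify words with paths of the
    automaton.

    Lower inequality: if quadratic forms [Q v] satisfy the lifted LMIs with rate
    g, then along a path of length t the lifted product scales the forms by at
    most g^(2t). The forms are coercive and |x|^(2d) <= C |x^[d]|^2, so products of
    length t grow at most like g^(t/d).

    Upper inequality: for g > rho, the matrices g^(-d|p|) A_p^[d], p ranging over
    the paths from v, are uniformly bounded and include the identity, and the
    norms N_v(x) = sup_p |g^(-d|p|) A_p^[d] x| satisfy N_w(A_s^[d] x) <= g^d N_v(x)
    on edges. If an ellipsoidal norm |S_v x| satisfies N_v <= |S_v x| and
    c |S_v x|^2 <= N_v(x)^2, then the LMIs hold with rate g^d / sqrt c. By John's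
    theorem c can be taken arbitrarily close to 1/m, and this approximate form needs
    no compactness: if S dominates N_v and |det S| is close
    enough to its infimum, a direction x with N_v(x)^2 < c |S x|^2 and m c < 1
    could be squeezed (and its orthogonal complement slightly inflated) to lower
    the determinant by a fixed factor.

    The lifts x^[d] span their space by Kronecker substitution, which makes
    A |-> A^[d] well defined, multiplicative and bounded by a multiple of |A|^d. *)

Require Import Defs.
From Stdlib Require ClassicalEpsilon.
From HB Require Import structures.
From mathcomp Require Import all_boot all_order all_algebra.
From mathcomp Require Import all_classical all_reals all_analysis.
From mathcomp Require Import perm ring lra.

Set Implicit Arguments.
Unset Strict Implicit.
Unset Printing Implicit Defensive.

Import Order.TTheory GRing.Theory Num.Theory.
Import numFieldNormedType.Exports.
Local Open Scope ring_scope.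

(** * Sums of squares *)

Definition dot (R : realType) (m : nat) (x y : 'cV[R]_m) : R :=
  \sum_(i < m) x i 0 * y i 0.

Definition fro2 (R : realType) (m n : nat) (M : 'M[R]_(m, n)) : R :=
  \sum_(i < m) \sum_(j < n) M i j ^+ 2.

Section SumsOfSquares.
Variable R : realType.

(** Discriminant criterion, tested at the vertex [- b / a]; if [a = 0], a nonzero slope would let
    the affine function reach -1. All Cauchy-Schwarz inequalities below come from it. *)
Lemma sqr_le_mul_of_quad_ge0 (a b c : R) : 0 <= a ->
  (forall s, 0 <= a * s ^+ 2 + 2 * b * s + c) -> b ^+ 2 <= a * c.
Proof.
rewrite le_eqVlt => /orP[/eqP <-|a0] H.
  rewrite mul0r; have [->|b0] := eqVneq b 0; first by rewrite expr0n.
  have := H (- (c + 1) / (2 * b)).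
  have -> : 0 * (- (c + 1) / (2 * b)) ^+ 2 + 2 * b * (- (c + 1) / (2 * b)) + c
     = -1 by field.
  by rewrite ler0N1.
have := H (- b / a).
have -> : a * (- b / a) ^+ 2 + 2 * b * (- b / a) + c = (a * c - b ^+ 2) / a.
  by field; rewrite gt_eqF.
by rewrite pmulr_lge0 ?invr_gt0// subr_ge0.
Qed.

Lemma cauchy_schwarz_sum (I : finType) (a b : I -> R) :
  (\sum_i a i * b i) ^+ 2 <= (\sum_i a i ^+ 2) * (\sum_i b i ^+ 2).
Proof.
apply: sqr_le_mul_of_quad_ge0 => [|s].
  by apply: sumr_ge0 => i _; apply: sqr_ge0.
have -> : (\sum_i a i ^+ 2) * s ^+ 2 + 2 * (\sum_i a i * b i) * s + \sum_i b i ^+ 2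
   = \sum_i (a i * s + b i) ^+ 2.
  rewrite mulr_suml mulr_sumr mulr_suml -!big_split /=.
  by apply: eq_bigr => i _; ring.
by apply: sumr_ge0 => i _; apply: sqr_ge0.
Qed.

Lemma fro2_ge0 m n (M : 'M[R]_(m, n)) : 0 <= fro2 M.
Proof. by apply: sumr_ge0 => i _; apply: sumr_ge0 => j _; apply: sqr_ge0. Qed.

Lemma sqr_entry_le_fro2 m n (M : 'M[R]_(m, n)) i j : M i j ^+ 2 <= fro2 M.
Proof.
rewrite /fro2 (bigD1 i)//= (bigD1 j)//= -addrA lerDl.
apply: addr_ge0; first by apply: sumr_ge0 => k _; apply: sqr_ge0.
by apply: sumr_ge0 => k _; apply: sumr_ge0 => l _; apply: sqr_ge0.
Qed.

Lemma fro2_eq0 m n (M : 'M[R]_(m, n)) : (fro2 M == 0) = (M == 0).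
Proof.
apply/eqP/eqP => [M0|->]; last first.
  by rewrite /fro2 big1// => i _; rewrite big1// => j _; rewrite mxE expr0n.
apply/matrixP => i j; rewrite mxE; apply/eqP; rewrite -sqrf_eq0 eq_le sqr_ge0 andbT.
by rewrite -M0 sqr_entry_le_fro2.
Qed.

Lemma fro2Z m n a (M : 'M[R]_(m, n)) : fro2 (a *: M) = a ^+ 2 * fro2 M.
Proof.
rewrite /fro2 mulr_sumr; apply: eq_bigr => i _; rewrite mulr_sumr.
by apply: eq_bigr => j _; rewrite mxE exprMn.
Qed.

Lemma fro2_col_sum m n (M : 'M[R]_(m, n)) : fro2 M = \sum_j fro2 (col j M).
Proof.
rewrite /fro2 exchange_big; apply: eq_bigr => j _; apply: eq_bigr => i _.
by rewrite big_ord1 mxE.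
Qed.

Lemma fro2M m n p (M : 'M[R]_(m, n)) (N : 'M[R]_(n, p)) :
  fro2 (M *m N) <= fro2 M * fro2 N.
Proof.
rewrite [fro2 N]/fro2 exchange_big /= /fro2 mulr_suml.
apply: ler_sum => i _; rewrite mulr_sumr; apply: ler_sum => j _.
by rewrite mxE; apply: cauchy_schwarz_sum.
Qed.

Lemma dotxx m (x : 'cV[R]_m) : dot x x = fro2 x.
Proof. by apply: eq_bigr => i _; rewrite big_ord1 expr2. Qed.

Lemma dotE m (x y : 'cV[R]_m) : dot x y = (x^T *m y) 0 0.
Proof. by rewrite mxE; apply: eq_bigr => i _; rewrite mxE. Qed.

Lemma dotC m (x y : 'cV[R]_m) : dot x y = dot y x.
Proof. by apply: eq_bigr => i _; rewrite mulrC. Qed.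

Lemma dotDr m (x y z : 'cV[R]_m) : dot x (y + z) = dot x y + dot x z.
Proof. by rewrite /dot -big_split; apply: eq_bigr => i _; rewrite mxE mulrDr. Qed.

Lemma dotZr m a (x y : 'cV[R]_m) : dot x (a *: y) = a * dot x y.
Proof. by rewrite /dot mulr_sumr; apply: eq_bigr => i _; rewrite mxE mulrCA. Qed.

Lemma fro2D m (x y : 'cV[R]_m) a b :
  fro2 (a *: x + b *: y) = a ^+ 2 * fro2 x + 2 * (a * b) * dot x y + b ^+ 2 * fro2 y.
Proof.
rewrite -!dotxx /dot !mulr_sumr -!big_split /=; apply: eq_bigr => i _.
by rewrite !mxE; ring.
Qed.

Lemma dot_sqr_le m (x y : 'cV[R]_m) : dot x y ^+ 2 <= fro2 x * fro2 y.
Proof.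
rewrite -!dotxx; apply: (le_trans (cauchy_schwarz_sum _ _)).
by under eq_bigr do rewrite expr2; under [X in _ * X]eq_bigr do rewrite expr2.
Qed.

Lemma quadform_tr_mul m n (S : 'M[R]_(n, m)) (x : 'cV[R]_m) :
  (x^T *m (S^T *m S) *m x) 0 0 = fro2 (S *m x).
Proof. by rewrite -dotxx dotE trmx_mul !mulmxA. Qed.

Lemma quadform_cauchy_schwarz m (Q : 'M[R]_m) (x y : 'cV[R]_m) :
  Q^T = Q -> (forall z : 'cV[R]_m, 0 <= (z^T *m Q *m z) 0 0) ->
  (y^T *m Q *m x) 0 0 ^+ 2 <= (x^T *m Q *m x) 0 0 * (y^T *m Q *m y) 0 0.
Proof.
move=> Qs Q0; apply: sqr_le_mul_of_quad_ge0 => // s.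
have yx : (y^T *m Q *m x) 0 0 = (x^T *m Q *m y) 0 0.
  by rewrite -[x in LHS]trmxK -[Q in LHS]trmxK -!trmx_mul mxE Qs mulmxA.
have := Q0 (s *: x + y); congr (0 <= _).
have addE (A B : 'M[R]_1) : (A + B) 0 0 = A 0 0 + B 0 0 by rewrite mxE.
have scaleE (t : R) (A : 'M[R]_1) : (t *: A) 0 0 = t * A 0 0 by rewrite mxE.
have -> : (s *: x + y)^T = s *: x^T + y^T by apply/matrixP => i j; rewrite !mxE.
rewrite !mulmxDl !mulmxDr -?scalemxAl -?scalemxAr -?scalemxAl.
by rewrite !(addE, scaleE) yx; ring.
Qed.

End SumsOfSquares.

(** * An approximate John ellipsoid *)

Section John.
Variable R : realType.

Lemma bernoulli_inequality (z : R) (k : nat) :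
  z <= 1 -> 1 - k%:R * z <= (1 - z) ^+ k.
Proof.
move=> z1; elim: k => [|k IH]; first by rewrite expr0 mul0r subr0.
rewrite exprS; apply: le_trans (ler_wpM2l _ IH); last by rewrite subr_ge0.
rewrite -subr_ge0.
have -> : (1 - z) * (1 - k%:R * z) - (1 - k.+1%:R * z) = k%:R * z ^+ 2.
  by rewrite -natr1; ring.
by rewrite mulr_ge0// sqr_ge0.
Qed.

(* To first order in [b] the left-hand side of the last inequality is
   [1 - b + k b c / (1 - c)], which is below [1] exactly when [(k + 1) c < 1]. *)
Lemma john_squeeze_factor (k : nat) (c : R) : 0 < c -> k.+1%:R * c < 1 ->
  exists b : R, [/\ 0 < b, b < 1, 0 < 1 - b - c &
    (1 - b) * (1 + b * c / (1 - b - c)) ^+ k < 1].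
Proof.
move=> c0; rewrite -natr1 mulrDl mul1r => kc1.
have kc0 : 0 <= k%:R * c by rewrite mulr_ge0// ltW.
(* Half of the slack in [(k + 1) c < 1], so that [1 - b - c - k c] is again [b], hence positive. *)
pose b := (1 - (k%:R * c + c)) / 2; exists b.
have b0 : 0 < b by rewrite /b; lra.
have bc : 0 < 1 - b - c by rewrite /b; lra.
have b1 : b < 1 by rewrite /b; lra.
split=> //.
set a := 1 + b * c / _.
have a0 : 0 < a.
  apply: ltr_pwDl => //; apply: mulr_ge0; last by rewrite invr_ge0 ltW.
  by apply: mulr_ge0; exact: ltW.
(* Chosen so that [1 - z] is the inverse of [a]; Bernoulli then bounds [a ^- k] from below by
   [1 - k z], which exceeds [1 - b]. *)
pose z := b * c / ((1 - b) * (1 - c)).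
have d0 : 0 < (1 - b) * (1 - c) by rewrite mulr_gt0; lra.
have za : (1 - z) * a = 1.
  by rewrite /z /a; field; rewrite !gt_eqF; lra.
have z1 : z <= 1.
  by rewrite -subr_ge0 -(pmulr_lge0 _ a0) za.
have kz : 1 - b < 1 - k%:R * z.
  rewrite ltrD2l ltrN2 /z mulrA ltr_pdivrMr// mulrCA ltr_pM2l//.
  have : 0 <= b * c by rewrite mulr_ge0 // ltW.
  rewrite /b; nra.
have := lt_le_trans kz (bernoulli_inequality k z1).
rewrite -(ltr_pM2r (exprn_gt0 k a0)) -exprMn za expr1n; exact.
Qed.

(* [p, q] are the cross term and the restriction to the orthogonal complement of
   a quadratic form between [0] and the identity, whose value in the
   distinguished direction is [c' <= c]. *)
Lemma john_squeezed_bound (b c c' p q Y s : R) :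
  0 <= b -> 0 < 1 - b - c -> 0 <= c' -> c' <= c -> 0 <= Y ->
  p ^+ 2 <= c' * q -> p ^+ 2 <= (1 - c') * (Y - q) ->
  s ^+ 2 * c' + 2 * s * p + q <= (1 - b) * s ^+ 2 + (1 + b * c / (1 - b - c)) * Y.
Proof.
move=> b0 bc c'0 c'c Y0 p1 p2.
set a := b * c / _.
pose e := 1 - b - c'.
have e0 : 0 < e by rewrite /e; lra.
pose f := (1 + a) * Y - q.
have ae : b * c' <= a * e.
  have -> : a * e = b * c * (e / (1 - b - c)) by rewrite /a; field; rewrite gt_eqF.
  have e1 : 1 <= e / (1 - b - c) by rewrite ler_pdivlMr// mul1r /e; lra.
  apply: (@le_trans _ _ (b * c)); first exact: ler_wpM2l.
  by rewrite ler_peMr// mulr_ge0//; lra.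
(* [e] and [f] are the outer coefficients, as a quadratic in [s], of the right side minus the left
   side. Averaging the two hypotheses on [p ^+ 2] with weights [b] and [1 - b] bounds the
   discriminant. *)
have pf : p ^+ 2 <= e * f.
  have b1 : 0 <= 1 - b by lra.
  have h1 : b * p ^+ 2 <= b * (c' * q) by exact: ler_wpM2l.
  have h2 : (1 - b) * p ^+ 2 <= (1 - b) * ((1 - c') * (Y - q)) by exact: ler_wpM2l.
  have h3 : b * c' * Y <= a * e * Y by exact: ler_wpM2r.
  move: h1 h2 h3; rewrite /f /e; lra.
have : 0 <= e * (e * s ^+ 2 - 2 * s * p + f).
  have -> : e * (e * s ^+ 2 - 2 * s * p + f) = (e * s - p) ^+ 2 + (e * f - p ^+ 2).
    by ring.
  by rewrite addr_ge0 ?sqr_ge0// subr_ge0.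
rewrite pmulr_rge0// /e /f; lra.
Qed.

(** The bordered matrix [N] has its upper right block cleared in two ways, by a column and by a row
    operation; comparing the two Schur complements gives the formula. *)
Lemma det_scalar_add_rank1 (k : nat) (al ka : R) (u : 'cV[R]_k.+1) :
  al != 0 -> fro2 u = 1 -> \det (al%:M + ka *: (u *m u^T)) = al ^+ k * (al + ka).
Proof.
move=> al0 u1.
pose N := block_mx (1%:M : 'M[R]_1) (- u^T) (ka *: u) al%:M.
have uu : u^T *m u = 1%:M.
  by apply/matrixP => i j; rewrite !ord1 -dotE dotxx u1 mxE.
have <- : \det N = \det (al%:M + ka *: (u *m u^T)).
  have : N *m block_mx 1%:M u^T 0 1%:M
      = block_mx 1%:M 0 (ka *: u) (al%:M + ka *: (u *m u^T)).
    rewrite mulmx_block !mulmx1 !mulmx0 !mul1mx !addr0 subrr.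
    by rewrite -scalemxAl addrC.
  move/(congr1 determinant); rewrite det_mulmx det_ublock det_lblock.
  by rewrite !det1 !mul1r mulr1.
have : block_mx 1%:M (al^-1 *: u^T) 0 1%:M *m N
    = block_mx ((1 + al^-1 * ka)%:M) 0 (ka *: u) al%:M.
  rewrite mulmx_block !mulmx1 !mul0mx !mul1mx !add0r.
  rewrite -scalemxAl -scalemxAr uu scalerA scalemx1 -raddfD /=.
  by rewrite -scalemxAl mul_mx_scalar scalerA mulVf// scale1r addNr.
move/(congr1 determinant); rewrite det_mulmx det_ublock det_lblock.
rewrite !det1 !mul1r !det_scalar expr1 => ->.
by rewrite exprS; field.
Qed.

Lemma det_entries_le1 (k : nat) (M : 'M[R]_k) :
  (forall i j, `|M i j| <= 1) -> `|\det M| <= (k`!)%:R.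
Proof.
move=> M1; rewrite /determinant (le_trans (ler_norm_sum _ _ _))//.
rewrite -card_Sn -sum1_card natr_sum ler_sum// => s _.
rewrite normrM normrX normrN1 expr1n mul1r normr_prod.
by apply: prodr_ile1 => i _; rewrite normr_ge0 M1.
Qed.

(** The inverse is a contraction, so its entries are at most 1 in absolute value and the Leibniz
    expansion bounds its determinant. This keeps the infimum in [approx_john] positive. *)
Lemma det_expanding_ge (k : nat) (S : 'M[R]_k) : S \in unitmx ->
  (forall x : 'cV[R]_k, fro2 x <= fro2 (S *m x)) -> (k`!)%:R^-1 <= `|\det S|.
Proof.
move=> Su Sx.
have dS0 : 0 < `|\det S| by rewrite normr_gt0 -unitfE -unitmxE.
have k0 : 0 < (k`!)%:R :> R by rewrite ltr0n fact_gt0.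
suff : `|\det (invmx S)| <= (k`!)%:R.
  by rewrite det_inv normrV ?unitfE ?normr_eq0 -?normr_gt0// -lef_pV2 ?posrE ?invr_gt0// invrK.
apply: det_entries_le1 => i j.
rewrite -(@expr_le1 _ 2)//.
have := Sx (invmx S *m delta_mx j 0); rewrite mulKVmx//.
have -> : fro2 (delta_mx j 0 : 'cV[R]_k) = 1.
  rewrite /fro2 (bigD1 j)//= big_ord1 mxE !eqxx expr1n big1 ?addr0// => l lj.
  by rewrite big_ord1 mxE (negbTE lj) expr0n.
apply: le_trans.
rewrite -colE -normrX ger0_norm ?sqr_ge0//.
have := sqr_entry_le_fro2 (col j (invmx S)) i 0.
by rewrite mxE.
Qed.

Lemma john_improve (k : nat) (K : Type) (B : K -> 'M[R]_k.+1) (b c : R)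
    (S : 'M[R]_k.+1) (x : 'cV[R]_k.+1) :
  0 < b -> b < 1 -> 0 < 1 - b - c -> 0 < c -> S \in unitmx ->
  (forall i (z : 'cV[R]_k.+1), fro2 (B i *m z) <= fro2 (S *m z)) ->
  0 < fro2 (S *m x) -> (forall i, fro2 (B i *m x) < c * fro2 (S *m x)) ->
  exists S' : 'M[R]_k.+1, [/\ S' \in unitmx,
    forall i (z : 'cV[R]_k.+1), fro2 (B i *m z) <= fro2 (S' *m z) &
    \det S' ^+ 2 = (1 - b) * (1 + b * c / (1 - b - c)) ^+ k * \det S ^+ 2].
Proof.
move=> b0 b1 bc c0 Su Sfeas Sx0 xbad.
set a := 1 + b * c / _.
have a0 : 0 < a.
  apply: ltr_pwDl => //; apply: mulr_ge0; last by rewrite invr_ge0 ltW.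
  by apply: mulr_ge0; exact: ltW.
pose al := Num.sqrt a; pose be := Num.sqrt (1 - b).
have al2 : al ^+ 2 = a by rewrite sqr_sqrtr// ltW.
have be2 : be ^+ 2 = 1 - b by rewrite sqr_sqrtr// subr_ge0 ltW.
have al0 : al != 0 by rewrite gt_eqF// sqrtr_gt0.
have be0 : be != 0 by rewrite gt_eqF// sqrtr_gt0 subr_gt0.
pose la := (Num.sqrt (fro2 (S *m x)))^-1.
have la2 : la ^+ 2 = (fro2 (S *m x))^-1 by rewrite exprVn sqr_sqrtr// ltW.
pose u := la *: (S *m x).
have u1 : fro2 u = 1 by rewrite fro2Z la2 mulVf// gt_eqF.
(* [D] scales the unit vector [u] by [be] and its orthogonal complement by [al]: the bad direction
   is squeezed, the others are slightly inflated. *)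
pose D := al%:M + (be - al) *: (u *m u^T).
have detD : \det D = al ^+ k * be.
  by rewrite det_scalar_add_rank1// addrCA subrr addr0.
have Dw w : fro2 (D *m w) = (1 - b) * dot u w ^+ 2 + a * fro2 (w - dot u w *: u).
  have -> : D *m w = al *: (w - dot u w *: u) + (be * dot u w) *: u.
    rewrite mulmxDl mul_scalar_mx -scalemxAl -mulmxA.
    have -> : u *m (u^T *m w) = dot u w *: u.
      by rewrite [u^T *m w]mx11_scalar -dotE mul_mx_scalar.
    by rewrite scalerBr scalerBl !scalerA addrA addrAC.
  have yu : dot (w - dot u w *: u) u = 0.
    by rewrite dotC -scaleNr dotDr dotZr dotxx u1 mulr1 subrr.
  by rewrite fro2D yu u1 exprMn al2 be2; ring.
exists (D *m S); split.
- by rewrite unitmx_mul Su andbT unitmxE unitfE detD mulf_neq0// expf_neq0.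
- move=> i z; rewrite -mulmxA Dw.
  pose M := B i *m invmx S; pose w := S *m z.
  have -> : B i *m z = M *m w by rewrite -mulmxA mulKmx.
  have Mle (v : 'cV[R]_k.+1) : fro2 (M *m v) <= fro2 v.
    by have := Sfeas i (invmx S *m v); rewrite mulKVmx// mulmxA.
  pose s := dot u w; pose y := w - s *: u.
  have uy : dot u y = 0.
    by rewrite /y -scaleNr dotDr dotZr dotxx u1 mulr1 subrr.
  have -> : M *m w = s *: (M *m u) + 1 *: (M *m y).
    by rewrite scale1r scalemxAr -mulmxDr /y addrC subrK.
  rewrite fro2D expr1n mul1r mulr1.
  rewrite -/w -/s -/y.
  apply: (@john_squeezed_bound _ c); rewrite ?fro2_ge0//.
  + exact: ltW.
  + rewrite -mulmxA /u -scalemxAr mulKmx// -scalemxAr fro2Z la2 mulrC.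
    by rewrite ler_pdivrMr// ltW.
  + exact: dot_sqr_le.
  (* Cauchy-Schwarz for the form [|v|^2 - |M v|^2], nonnegative since [M] is a contraction; as [u]
     and [y] are orthogonal, its cross term is minus that of [M]. *)
  + rewrite -sqrrN; apply: sqr_le_mul_of_quad_ge0 => [|t].
      by rewrite subr_ge0 -u1.
    have := Mle (t *: u + 1 *: y).
    rewrite mulmxDr -!scalemxAr !fro2D uy u1 -subr_ge0.
    by congr (0 <= _); ring.
- rewrite det_mulmx detD !exprMn be2 -exprM mulnC exprM al2.
  by ring.
Qed.

Lemma approx_john (m : nat) (K : Type) (B : K -> 'M[R]_m) (i0 : K) (C c : R) :
  B i0 = 1%:M -> (forall i (x : 'cV[R]_m), fro2 (B i *m x) <= C * fro2 x) ->
  0 < c -> m%:R * c < 1 ->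
  exists S : 'M[R]_m, [/\ S \in unitmx,
    forall i (x : 'cV[R]_m), fro2 (B i *m x) <= fro2 (S *m x) &
    forall x : 'cV[R]_m, exists i, c * fro2 (S *m x) <= fro2 (B i *m x)].
Proof.
case: m B => [|k] B Bi0 BC c0 kc1.
  have fro20 (x : 'cV[R]_0) : fro2 x = 0 by rewrite /fro2 big_ord0.
  exists 1%:M; split; first exact: unitmx1.
    by move=> i x; rewrite !fro20.
  by move=> x; exists i0; rewrite !fro20 mulr0.
have [b [b0 b1 bc ka1]] := john_squeeze_factor c0 kc1.
set ka := _ * _ in ka1.
have a0 : 0 < 1 + b * c / (1 - b - c).
  apply: ltr_pwDl => //; apply: mulr_ge0; last by rewrite invr_ge0 ltW.
  by apply: mulr_ge0; exact: ltW.
have ka0 : 0 < ka by rewrite mulr_gt0 ?subr_gt0// exprn_gt0.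
pose feas S := S \in unitmx /\ forall i (x : 'cV[R]_k.+1), fro2 (B i *m x) <= fro2 (S *m x).
pose dets := [set t : R | exists2 S, feas S & t = \det S ^+ 2]%classic.
pose l : R := ((k.+1)`!%:R^-1) ^+ 2.
have l0 : 0 < l by rewrite exprn_gt0// invr_gt0 ltr0n fact_gt0.
have lb : lbound dets l.
  move=> t [S [Su Sfeas] ->].
  have : (k.+1)`!%:R^-1 <= `|\det S|.
    by apply: det_expanding_ge => // x; have := Sfeas i0 x; rewrite Bi0 mul1mx.
  move=> dS; rewrite -(real_normK (num_real (\det S))) /l lerXn2r//.
  by rewrite nnegrE invr_ge0 ler0n.
have ne : (dets !=set0)%classic.
  pose r := Num.sqrt (`|C| + 1).
  exists (\det (r%:M : 'M[R]_k.+1) ^+ 2), r%:M => //; split.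
    rewrite unitmxE det_scalar unitfE expf_neq0// gt_eqF// sqrtr_gt0.
    by rewrite ltr_wpDl.
  move=> i x; rewrite mul_scalar_mx fro2Z sqr_sqrtr ?addr_ge0//.
  apply: le_trans (BC i x) _; rewrite ler_wpM2r ?fro2_ge0//.
  by rewrite (le_trans (ler_norm _))// lerDl.
have il : l <= inf dets by exact: lb_le_inf.
(* As the infimum is positive and [ka < 1], some feasible [S] has [ka * \det S ^+ 2] below the
   infimum; improving it would undercut the infimum. *)
have : inf dets < inf dets / ka.
  by rewrite ltr_pdivlMr// gtr_pMr// (lt_le_trans l0).
move=> /(inf_lt ne)[t [S [Su Sfeas] ->]].
rewrite ltr_pdivlMr// => detS.
exists S; split=> // x; apply/not_existsP => xbad.
have xb i : fro2 (B i *m x) < c * fro2 (S *m x).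
  by rewrite ltNge; apply/negP; exact: xbad.
have Sx0 : 0 < fro2 (S *m x).
  have := le_lt_trans (fro2_ge0 _) (xb i0).
  by rewrite pmulr_rgt0.
have [S' [S'u S'feas detS']] := john_improve b0 b1 bc c0 Su Sfeas Sx0 xb.
have : inf dets <= \det S' ^+ 2.
  by apply: ge_inf; [exists l|exists S'].
by rewrite detS' leNgt -/ka mulrC detS.
Qed.

End John.

(** * The lift of vectors and matrices *)

Section Lift.
Variable R : realType.

(** Stars and bars, through the count of ordered partitions; for [n = 0] both sides vanish because
    [d] is positive. *)
Lemma multi_index_card (n d : nat) :
  (1 <= d)%N -> #|{: multi_index n d}| = 'C(n + d - 1, d).
Proof.
move=> d0; rewrite card_sig; case: n => [|m].
  rewrite bin_small; last by rewrite add0n subn1 prednK.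
  by apply: eq_card0 => a; rewrite !inE big_ord0 ltn_eqF.
rewrite addSn subn1 /=.
have := bin_sub (leq_addr d m); rewrite addKn => ->.
rewrite -card_ord_partitions -!sum1_card.
pose h (t : m.+1.-tuple 'I_d.+1) := [ffun i => tnth t i].
have hbij : bijective h.
  exists (fun a : {ffun 'I_m.+1 -> 'I_d.+1} => [tuple a i | i < m.+1]).
    by move=> t; apply: eq_from_tnth => i; rewrite tnth_mktuple ffunE.
  by move=> a; apply/ffunP => i; rewrite ffunE tnth_mktuple.
rewrite (reindex h) /=; last exact: onW_bij.
apply: eq_bigl => t; rewrite !inE big_tuple.
by under eq_bigr do rewrite ffunE.
Qed.

Definition monomial (n d : nat) (a : multi_index n d) (x : 'cV[R]_n) : R :=
  \prod_(i < n) x i 0 ^+ (val a i : nat).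

Lemma multinom_gt0 (n d : nat) (a : multi_index n d) : 0 < multinom R a.
Proof.
rewrite divr_gt0 ?ltr0n ?fact_gt0//.
by apply: prodn_gt0 => i; exact: fact_gt0.
Qed.

Lemma multinom_ge0 (n d : nat) (a : multi_index n d) : 0 <= multinom R a.
Proof. exact/ltW/multinom_gt0. Qed.

Lemma liftvE (n d : nat) (x : 'cV[R]_n) k :
  liftv d x k 0 = Num.sqrt (multinom R (enum_val k)) * monomial (enum_val k) x.
Proof. by rewrite mxE. Qed.

Lemma exponents_subproof (n d : nat) (f : {ffun 'I_d -> 'I_n}) :
  \sum_(i < n)
    (([ffun i => inord #|[pred j | f j == i]|] : {ffun 'I_n -> 'I_d.+1}) i : nat)
  == d.
Proof.
apply/eqP; under eq_bigr => i _.
  rewrite ffunE inordK; last by rewrite ltnS -[X in (_ <= X)%N]card_ord max_card.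
  over.
rewrite -[RHS]card_ord -[RHS]sum1_card (partition_big f xpredT)//=.
by apply: eq_bigr => i _; rewrite -sum1_card.
Qed.

(** The letter count of a word [f] of length [d]. Products of [d] sums expand over words, and
    grouping words by letter count turns them into sums over monomials. *)
Definition exponents (n d : nat) (f : {ffun 'I_d -> 'I_n}) : multi_index n d :=
  exist (fun a : {ffun 'I_n -> 'I_d.+1} => \sum_(i < n) (a i : nat) == d) _
    (exponents_subproof f).

Lemma prod_entries_monomial (n d : nat) (f : {ffun 'I_d -> 'I_n}) (x : 'cV[R]_n) :
  \prod_(j < d) x (f j) 0 = monomial (exponents f) x.
Proof.
rewrite (partition_big f xpredT)//=; apply: eq_bigr => i _.
rewrite ffunE inordK; last by rewrite ltnS -[X in (_ <= X)%N]card_ord max_card.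
by rewrite -prodr_const; apply: eq_bigr => j /eqP ->.
Qed.

Lemma monomial_prod_entries (n d : nat) (a : multi_index n d) :
  exists t : 'I_d -> 'I_n, forall x, monomial a x = \prod_(j < d) x (t j) 0.
Proof.
pose L := flatten [seq nseq (val a i : nat) i | i <- enum 'I_n].
have sL : size L == d.
  rewrite size_flatten /shape -map_comp sumnE big_map big_enum /=.
  by under eq_bigr do rewrite size_nseq; exact: (valP a).
exists (tnth (Tuple sL)) => x; rewrite -(big_tuple _ _ (Tuple sL) xpredT (fun i => x i 0)) /=.
rewrite big_flatten big_map big_enum /=; apply: eq_bigr => i _.
by rewrite big_nseq iter_mulr_1.
Qed.

Lemma monomial_mulmx (n d : nat) (a : multi_index n d) (M : 'M[R]_n) :
  exists c : multi_index n d -> R,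
    forall x, monomial a (M *m x) = \sum_b c b * monomial b x.
Proof.
have [t at_] := monomial_prod_entries a.
exists (fun b => \sum_(f : {ffun 'I_d -> 'I_n} | exponents f == b)
                   \prod_(j < d) M (t j) (f j)) => x.
rewrite at_; under eq_bigr do rewrite mxE.
rewrite bigA_distr_bigA (partition_big (@exponents n d) xpredT)//=.
apply: eq_bigr => b _; rewrite mulr_suml; apply: eq_bigr => f /eqP <-.
by rewrite big_split /= prod_entries_monomial.
Qed.

Lemma liftmxP (n d : nat) (A : 'M[R]_n) (x : 'cV[R]_n) :
  liftmx d A *m liftv d x = liftv d (A *m x).
Proof.
move: x; apply: (ClassicalEpsilon.epsilon_spec _ (fun B => forall x, B *m liftv d x = liftv d (A *m x))).
have /choice[c cP] := fun a : multi_index n d => monomial_mulmx a A.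
(* An explicit witness for the [epsilon] in [liftmx]: the substitution matrix on monomials,
   conjugated by the square roots of the multinomials. *)
exists (\matrix_(k, l) (Num.sqrt (multinom R (enum_val k)) *
   c (enum_val k) (enum_val l) / Num.sqrt (multinom R (enum_val l)))) => x.
apply/colP => k; rewrite liftvE mxE cP mulr_sumr.
rewrite [RHS](reindex _ (onW_bij _ (enum_val_bij _))) /=.
apply: eq_bigr => l _; rewrite mxE liftvE; field.
by rewrite gt_eqF// sqrtr_gt0 multinom_gt0.
Qed.

Lemma digits_inj (B n : nat) (a b : 'I_n -> 'I_B) :
  (\sum_(i < n) a i * B ^ i = \sum_(i < n) b i * B ^ i)%N -> a =1 b.
Proof.
elim: n a b => [|n IH] a b; first by move=> _ [].
case: B IH a b => [|B] IH a b; first by case: (a ord0).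
rewrite !big_ord_recl expn0 !muln1.
have shift (c : 'I_n.+1 -> 'I_B.+1) :
    (\sum_(i < n) c (lift ord0 i) * B.+1 ^ lift ord0 i
     = (\sum_(i < n) c (lift ord0 i) * B.+1 ^ i) * B.+1)%N.
  by rewrite big_distrl; apply: eq_bigr => i _; rewrite /= expnSr mulnA.
rewrite !shift => e.
have e0 : a ord0 = b ord0.
  apply: val_inj => /=; move: (congr1 (modn^~ B.+1) e).
  by rewrite ![(_ + _ * B.+1)%N]addnC !modnMDl !modn_small.
have /IH e1 : (\sum_(i < n) a (lift ord0 i) * B.+1 ^ i =
     \sum_(i < n) b (lift ord0 i) * B.+1 ^ i)%N.
  by move: e; rewrite e0 => /addnI/eqP; rewrite eqn_pmul2r// => /eqP.
by move=> i; case: (unliftP ord0 i) => [j|] ->.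
Qed.

Lemma digits_bound (B n : nat) (a : 'I_n -> 'I_B.+1) :
  (\sum_(i < n) a i * B.+1 ^ i < B.+1 ^ n)%N.
Proof.
elim: n a => [|n IH] a; first by rewrite big_ord0.
rewrite big_ord_recr /= expnS.
have := IH (fun i => a (widen_ord (leqnSn n) i)).
set s := (\sum_(i < n) _)%N => sn.
have : (a ord_max * B.+1 ^ n <= B * B.+1 ^ n)%N by rewrite leq_mul2r -ltnS ltn_ord orbT.
by rewrite mulSn => aB; rewrite -addSn leq_add.
Qed.

(* Kronecker substitution: along [x_i = t^((d + 1)^i)] distinct monomials of
   degree [d] become distinct powers of [t]. *)
Lemma liftv_spanning (n d : nat) :
  exists N (p : 'I_N -> 'cV[R]_n) (Y : 'M[R]_(N, #|{: multi_index n d}|)),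
    (\matrix_(k, j) liftv d (p j) k 0) *m Y = 1%:M.
Proof.
pose N := (d.+1 ^ n)%N.
pose code (a : multi_index n d) := (\sum_(i < n) val a i * d.+1 ^ i)%N.
have code_inj : injective code.
  by move=> a b /digits_inj ab; apply/val_inj/ffunP.
pose pt (t : R) : 'cV[R]_n := \col_i t ^+ (d.+1 ^ i).
have mono_pt a t : monomial a (pt t) = t ^+ code a.
  rewrite /monomial -prodrXr; apply: eq_bigr => i _.
  by rewrite mxE -exprM mulnC.
exists N, (fun j => pt (j : nat)%:R); apply/row_freeP/inj_row_free => v vX.
pose w k := v 0 k * Num.sqrt (multinom R (enum_val k)).
(* A vector [v] in the left kernel yields a polynomial of degree below [N] vanishing at the [N]
   points 0, ..., N - 1. Injectivity of [code] lets its coefficients be read off as the entries of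
   [w]. *)
pose p : {poly R} := \sum_k w k *: 'X^(code (enum_val k)).
have p0 : p = 0.
  pose rs : seq R := [seq j%:R | j <- iota 0 N].
  apply: (@roots_geq_poly_eq0 R p rs).
  - apply/allP => _ /mapP[j jN ->]; apply/eqP.
    move: jN; rewrite mem_iota /= => jN.
    move/rowP/(_ (Ordinal jN)): vX; rewrite !mxE; apply: etrans.
    rewrite horner_sum.
    apply: eq_bigr => k _.
    by rewrite hornerZ hornerXn mxE liftvE mono_pt mulrA.
  - by rewrite map_inj_uniq ?iota_uniq// => i j /eqP; rewrite eqr_nat => /eqP.
  - rewrite size_map size_iota; apply: (leq_trans (size_sum _ _ _)).
    apply/bigmax_leqP => k _; apply: leq_trans (size_scale_leq _ _) _.
    by rewrite size_polyXn; exact: digits_bound.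
apply/rowP => k; rewrite [RHS]mxE.
have /eqP : p`_(code (enum_val k)) = 0 by rewrite p0 coef0.
rewrite coef_sum (bigD1 k)//= coefZ coefXn eqxx mulr1 big1 ?addr0; last first.
  move=> l lk; rewrite coefZ coefXn [_ == _](negbTE _) ?mulr0//.
  by apply: contra lk => /eqP/code_inj/enum_val_inj ->.
by rewrite mulf_eq0 [X in _ || X]gt_eqF ?orbF ?sqrtr_gt0 ?multinom_gt0// => /eqP.
Qed.

Lemma mulmx_colsE (m p N : nat) (M : 'M[R]_(m, p)) (f : 'I_N -> 'cV[R]_p) i j :
  (M *m \matrix_(k, l) f l k 0) i j = (M *m f j) i 0.
Proof. by rewrite !mxE; apply: eq_bigr => k _; rewrite mxE. Qed.

Lemma liftmx_unique (n d : nat) (B C : 'M[R]_#|{: multi_index n d}|) :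
  (forall x, B *m liftv d x = C *m liftv d x) -> B = C.
Proof.
move=> BC; have [N [p [Y XY]]] := liftv_spanning n d.
rewrite -[B]mulmx1 -[C]mulmx1 -XY !mulmxA; congr (_ *m Y).
by apply/matrixP => k j; rewrite !mulmx_colsE BC.
Qed.

Lemma liftmx1 (n d : nat) : liftmx d (1%:M : 'M[R]_n) = 1%:M.
Proof. by apply: liftmx_unique => x; rewrite liftmxP !mul1mx. Qed.

Lemma liftmxM (n d : nat) (A B : 'M[R]_n) :
  liftmx d (A *m B) = liftmx d A *m liftmx d B.
Proof. by apply: liftmx_unique => x; rewrite -mulmxA !liftmxP mulmxA. Qed.

Lemma sqr_liftv_le (n d : nat) (x : 'cV[R]_n) k :
  liftv d x k 0 ^+ 2 <= multinom R (enum_val k) * fro2 x ^+ d.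
Proof.
rewrite liftvE exprMn sqr_sqrtr ?multinom_ge0// ler_pM2l ?multinom_gt0//.
set a := enum_val k.
have -> : fro2 x ^+ d = \prod_(i < n) fro2 x ^+ (val a i : nat).
  by rewrite prodrXr (eqP (valP a)).
rewrite /monomial -prodrXl; apply: ler_prod => i _.
rewrite -exprM mulnC exprM exprn_ge0 ?sqr_ge0//= lerXn2r ?nnegrE ?sqr_ge0 ?fro2_ge0//.
exact: sqr_entry_le_fro2.
Qed.

(** On the spanning points [p j] the lifted matrix takes the values [liftv d (A *m p j)], each
    controlled by [sqr_liftv_le]; the right inverse [Y] recovers the matrix from them. *)
Lemma liftmx_bound (n d : nat) :
  exists2 C : R, 0 <= C & forall A : 'M[R]_n, fro2 (liftmx d A) <= C * fro2 A ^+ d.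
Proof.
have [N [p [Y XY]]] := liftv_spanning n d.
pose C0 := \sum_(k < #|{: multi_index n d}|) \sum_(j < N)
             multinom R (enum_val k) * fro2 (p j) ^+ d.
have C00 : 0 <= C0.
  apply: sumr_ge0 => k _; apply: sumr_ge0 => j _.
  by rewrite mulr_ge0 ?exprn_ge0 ?fro2_ge0 ?multinom_ge0.
exists (C0 * fro2 Y) => [|A]; first by rewrite mulr_ge0// fro2_ge0.
have -> : liftmx d A = (\matrix_(k, j) liftv d (A *m p j) k 0) *m Y.
  rewrite -[LHS]mulmx1 -XY mulmxA; congr (_ *m Y).
  by apply/matrixP => k j; rewrite mulmx_colsE liftmxP [RHS]mxE.
apply: le_trans (fro2M _ _) _.
rewrite mulrAC ler_wpM2r ?fro2_ge0// [leLHS]/fro2 mulr_suml.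
apply: ler_sum => k _; rewrite mulr_suml; apply: ler_sum => j _.
rewrite mxE; apply: le_trans (sqr_liftv_le _ _) _.
rewrite -[leRHS]mulrA ler_pM2l ?multinom_gt0// -exprMn lerXn2r ?nnegrE ?mulr_ge0 ?fro2_ge0//.
by rewrite mulrC fro2M.
Qed.

(** Expanding the power over words makes each term a squared monomial, that is, a squared entry of
    the lift over its multinomial. The constant need not be sharp, since it disappears in the growth
    rate. *)
Lemma fro2_expr_le_liftv (n d : nat) :
  exists2 C : R, 0 <= C &
    forall x : 'cV[R]_n, fro2 x ^+ d <= C * fro2 (liftv d x).
Proof.
exists (\sum_(f : {ffun 'I_d -> 'I_n}) (multinom R (exponents f))^-1) => [|x].
  by apply: sumr_ge0 => f _; rewrite invr_ge0 multinom_ge0.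
rewrite -[X in _ ^+ X]card_ord -prodr_const -dotxx.
under eq_bigr do rewrite /dot.
rewrite bigA_distr_bigA mulr_suml; apply: ler_sum => f _.
rewrite big_split /= prod_entries_monomial [leRHS]mulrC ler_pdivlMr ?multinom_gt0//.
have := sqr_entry_le_fro2 (liftv d x) (enum_rank (exponents f)) 0.
apply: le_trans.
by rewrite liftvE enum_rankK exprMn sqr_sqrtr ?multinom_ge0// mulrC expr2.
Qed.

End Lift.

(** * Growth of submultiplicative sequences *)

Section Growth.
Variable R : realType.

Lemma geometric_dominated (C g h : R) : 0 <= g -> g < h ->
  exists N : nat, forall t, (N <= t)%N -> C * g ^+ t <= h ^+ t.
Proof.
move=> g0 gh; have h0 : 0 < h by exact: le_lt_trans gh.
have z1 : `|g / h| < 1 by rewrite ger0_norm ?divr_ge0 ?(ltW h0)// ltr_pdivrMr ?mul1r.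
have [N _ NP] := cvgr_lt _ (cvg_geometric C z1) _ ltr01.
exists N => t /NP /= /ltW; rewrite /= expr_div_n mulrA ler_pdivrMr ?exprn_gt0//.
by rewrite mul1r.
Qed.

Variable u : nat -> R.
Hypothesis u_ge0 : forall t, 0 <= u t.
Hypothesis u_submul : forall p q, u (p + q)%N <= u p * u q.

Definition root_seq (t : nat) : R := u t.+1 `^ (t.+1%:R^-1).
(** By Fekete's lemma, proved below as [root_seq_cvg], this infimum is the limit of [root_seq]. *)
Definition growth_rate : R := inf (range root_seq).

Lemma root_seq_ge0 t : 0 <= root_seq t.
Proof. exact: powR_ge0. Qed.

Lemma root_seqX t : root_seq t ^+ t.+1 = u t.+1.
Proof. by rewrite -powR_mulrn ?root_seq_ge0// -powRrM mulVf ?pnatr_eq0// powRr1. Qed.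

Lemma growth_rate_lb : has_lbound (range root_seq).
Proof. by exists 0 => _ [t _ <-]; exact: root_seq_ge0. Qed.

Lemma growth_rate_le t : growth_rate <= root_seq t.
Proof. by apply: ge_inf; [exact: growth_rate_lb|exists t]. Qed.

Lemma growth_rate_ge0 : 0 <= growth_rate.
Proof.
apply: lb_le_inf; first by exists (root_seq 0), 0%N.
by move=> _ [t _ <-]; exact: root_seq_ge0.
Qed.

Lemma growth_rate_bound g : growth_rate < g ->
  exists2 C, 0 <= C & forall t, u t.+1 <= C * g ^+ t.+1.
Proof.
move=> Lg; have g0 : 0 < g by exact: le_lt_trans growth_rate_ge0 Lg.
have /inf_lt[|_ [T _ <-] Tg] := Lg; first by exists (root_seq 0), 0%N.
have uT : u T.+1 <= g ^+ T.+1.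
  by rewrite -root_seqX lerXn2r ?nnegrE ?root_seq_ge0// ltW.
(* Covers the remainders of division by [T.+1], shifted to run from 1 to [T.+1] so that [u 0] never
   enters. *)
pose D := \sum_(r < T.+1) u r.+1 / g ^+ r.+1.
have D0 : 0 <= D by apply: sumr_ge0 => r _; rewrite divr_ge0// exprn_ge0// ltW.
have uD r : (r < T.+1)%N -> u r.+1 <= D * g ^+ r.+1.
  move=> rT; rewrite -ler_pdivrMr ?exprn_gt0// /D (bigD1 (Ordinal rT))//= lerDl.
  by apply: sumr_ge0 => s _; rewrite divr_ge0// exprn_ge0// ltW.
exists D => // t.
rewrite (divn_eq t T.+1) -addnS.
elim: (t %/ T.+1)%N => [|k IH].
  by rewrite mul0n add0n uD// ltn_mod.
rewrite mulSn -addnA exprD mulrCA.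
by apply: le_trans (u_submul _ _) _; apply: ler_pM.
Qed.

Lemma root_seq_cvg : (root_seq @ \oo --> growth_rate)%classic.
Proof.
apply/cvgrPdist_le => e e0.
(* Half of [e] gives a rate above the infimum; the other half absorbs the constant [C] for large
   [t]. *)
have Le : growth_rate < growth_rate + e / 2 by rewrite ltrDl divr_gt0.
have [C C0 uC] := growth_rate_bound Le.
have [|N NP] := geometric_dominated C (le_trans growth_rate_ge0 (ltW Le))
  (_ : _ < growth_rate + e); first by rewrite ltrD2l ltr_pdivrMr// mulr_natr mulr2n ltrDl.
near=> t.
have Nt : (N <= t.+1)%N by apply: leqW; near: t; exact: nbhs_infty_ge.
have := le_trans (uC t) (NP _ Nt); rewrite -root_seqX.
rewrite ler_pXn2r ?nnegrE ?root_seq_ge0 ?addr_ge0 ?growth_rate_ge0 ?(ltW e0)//.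
by rewrite distrC ger0_norm ?subr_ge0 ?growth_rate_le// lerBlDr addrC.
Unshelve. all: by end_near. Qed.

Lemma growth_rate_le_of_bound (C g : R) : 0 <= g ->
  (forall t, u t.+1 <= C * g ^+ t.+1) -> growth_rate <= g.
Proof.
move=> g0 uC; rewrite leNgt; apply/negP => gL.
pose h := (g + growth_rate) / 2.
have gh : g < h by rewrite /h; lra.
have hL : h < growth_rate by rewrite /h; lra.
have [N NP] := geometric_dominated C g0 gh.
have := le_trans (uC N) (NP N.+1 (leqnSn N)); rewrite -root_seqX.
apply/negP; rewrite -ltNge ltrXn2r// ?(le_trans g0) ?ltW//.
by rewrite (lt_le_trans hL)// growth_rate_le.
Qed.

End Growth.

(** * Accepted words *)

Section Words.
Variables (R : realType) (V I : finType) (E : {set V * V * I}).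

Lemma acceptedP (s : seq I) : reflect
  (exists p : seq (V * V * I), [/\ all (fun e => e \in E) p,
     sorted (fun e f : V * V * I => e.1.2 == f.1.1) p & map (fun e => e.2) p = s])
  (accepted E s).
Proof.
apply: (iffP existsP) => [[p /and3P[pE ps /eqP pe]]|[p [pE ps pe]]].
  by exists p; split.
have sp : size p == size s by rewrite -pe size_map.
by exists (Tuple sp); rewrite /= pE ps pe eqxx.
Qed.

Lemma accepted_take_drop k (s : seq I) :
  accepted E s -> accepted E (take k s) /\ accepted E (drop k s).
Proof.
move=> /acceptedP[p [pE ps <-]]; split; apply/acceptedP.
  exists (take k p); rewrite map_take take_sorted//; split=> //.
  by apply/allP => e /mem_take; exact/allP.
exists (drop k p); rewrite map_drop drop_sorted//; split=> //.
by apply/allP => e /mem_drop; exact/allP.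
Qed.

(** Keeps track of the start node, which indexes the quadratic forms; the empty walk exists at every
    node and supplies the identity product. *)
Fixpoint walk (v : V) (p : seq (V * V * I)) : bool :=
  if p is e :: p' then [&& e \in E, e.1.1 == v & walk e.1.2 p'] else true.

Lemma walk_accepted v p : walk v p -> accepted E (map (fun e => e.2) p).
Proof.
move=> wp; apply/acceptedP; exists p; split=> //.
  by elim: p v wp => //= e p IH v /and3P[-> _ /IH].
case: p wp => //= e p /and3P[_ _].
by elim: p e => //= f p IH e /and3P[_ /eqP-> /IH ->]; rewrite eqxx.
Qed.

(** The first edge supplies the start node; the empty word determines none, and [V] may be empty. *)
Lemma accepted_walk (s : seq I) : accepted E s -> s != [::] ->
  exists v p, walk v p /\ s = map (fun e => e.2) p.
Proof.
case/acceptedP => -[|e p] [pE ep <-] //= _.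
case/andP: pE => eE pE; rewrite /= in ep.
exists e.1.1, (e :: p); split=> //=; rewrite eE eqxx /=.
elim: p e {eE} pE ep => //= f p IH e /andP[fE pE] /andP[/eqP -> fp].
by rewrite fE eqxx IH.
Qed.

Lemma prodmx_cat (m : nat) (A : I -> 'M[R]_m) s1 s2 :
  prodmx A (s1 ++ s2) = prodmx A s2 *m prodmx A s1.
Proof. by elim: s1 => [|i s IH] /=; rewrite ?mulmx1// IH mulmxA. Qed.

Lemma prodmx_liftsys (n d : nat) (A : I -> 'M[R]_n) s :
  prodmx (liftsys d A) s = liftmx d (prodmx A s).
Proof. by elim: s => [|i s IH] /=; rewrite ?liftmx1// IH liftmxM. Qed.

Lemma mxnorm_ge0 (m : nat) (M : 'M[R]_m) : 0 <= mxnorm M.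
Proof. exact: sqrtr_ge0. Qed.

Lemma mxnorm_sqr (m : nat) (M : 'M[R]_m) : mxnorm M ^+ 2 = fro2 M.
Proof. by rewrite sqr_sqrtr// fro2_ge0. Qed.

Lemma mxnormM (m : nat) (M N : 'M[R]_m) : mxnorm (M *m N) <= mxnorm M * mxnorm N.
Proof. by rewrite /mxnorm -sqrtrM ?fro2_ge0// ler_wsqrtr// fro2M. Qed.

Section MaxNorm.
Variables (m : nat) (A : I -> 'M[R]_m).

Definition max_norm (t : nat) : R :=
  \big[Num.max/0]_(s : t.-tuple I | accepted E s) mxnorm (prodmx A s).

Lemma mxnorm_le_max_norm (s : seq I) :
  accepted E s -> mxnorm (prodmx A s) <= max_norm (size s).
Proof.
move=> sE; have := @le_bigmax_cond _ R _ 0 (in_tuple s)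
  (fun s' : (size s).-tuple I => accepted E s')
  (fun s' : (size s).-tuple I => mxnorm (prodmx A s')) sE.
exact.
Qed.

Lemma max_norm_ge0 t : 0 <= max_norm t.
Proof. exact: bigmax_ge_id. Qed.

Lemma max_norm_submul p q : max_norm (p + q) <= max_norm p * max_norm q.
Proof.
apply: bigmax_le => [|s sE]; first by rewrite mulr_ge0 ?max_norm_ge0.
have [s1 s2] := accepted_take_drop p sE.
rewrite -[X in prodmx _ X](cat_take_drop p) prodmx_cat.
apply: le_trans (mxnormM _ _) _; rewrite mulrC.
have := mxnorm_le_max_norm s1; have := mxnorm_le_max_norm s2.
rewrite size_drop size_take_min size_tuple addKn (minn_idPl (leq_addr _ _)) => h2 h1.
by apply: ler_pM; rewrite ?mxnorm_ge0.
Qed.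

(** The root is monotone and fixes the default value 0, so it commutes with the maximum. *)
Lemma cjsr_seqE t : cjsr_seq E A t = root_seq max_norm t.
Proof.
suff [] : 0 <= max_norm t.+1 /\ cjsr_seq E A t = max_norm t.+1 `^ (t.+1%:R^-1) by [].
rewrite /cjsr_seq /max_norm.
apply: (big_rec2 (fun y x : R => 0 <= y /\ x = y `^ (t.+1%:R^-1))).
  by rewrite powR0// invr_eq0 pnatr_eq0.
move=> s x y _ [x0 ->]; rewrite le_max x0 orbT; split=> //.
have [xy|/ltW xy] := leP (mxnorm (prodmx A s)) x.
  by apply/max_idPr/ge0_ler_powR; rewrite ?nnegrE ?mxnorm_ge0.
by apply/max_idPl/ge0_ler_powR; rewrite ?nnegrE ?mxnorm_ge0.
Qed.

Lemma cjsrE : cjsr E A = growth_rate max_norm.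
Proof.
rewrite /cjsr (_ : cjsr_seq E A = root_seq max_norm); last exact/funext/cjsr_seqE.
apply: cvg_lim => //; apply: root_seq_cvg; [exact: max_norm_ge0|exact: max_norm_submul].
Qed.

End MaxNorm.
End Words.

(** * The two inequalities *)

Section Main.
Variables (R : realType) (V I : finType) (E : {set V * V * I}).

Lemma quadform_lmi (m : nat) (a : R) (Q Q' A : 'M[R]_m) (x : 'cV[R]_m) :
  (x^T *m (a *: Q - A^T *m Q' *m A) *m x) 0 0 =
  a * (x^T *m Q *m x) 0 0 - ((A *m x)^T *m Q' *m (A *m x)) 0 0.
Proof.
have subE (M N : 'M[R]_1) : (M - N) 0 0 = M 0 0 - N 0 0 by rewrite !mxE.
have scaleE (t : R) (M : 'M[R]_1) : (t *: M) 0 0 = t * M 0 0 by rewrite mxE.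
by rewrite mulmxBr mulmxBl subE -scalemxAr -scalemxAl scaleE trmx_mul !mulmxA.
Qed.

(** Compactness is avoided: with [z i] the i-th column of the inverse of [Q], the coordinate [x i 0]
    is the [Q]-product of [z i] and [x], and Cauchy-Schwarz for [Q] applies. *)
Lemma posdef_coercive (m : nat) (Q : 'M[R]_m) : posdef Q ->
  exists2 K : R, 0 <= K &
    forall x : 'cV[R]_m, fro2 x <= K * (x^T *m Q *m x) 0 0.
Proof.
move=> [Qs Qp].
have Q0 (x : 'cV[R]_m) : 0 <= (x^T *m Q *m x) 0 0.
  have [->|x0] := eqVneq x 0; last exact/ltW/Qp.
  by rewrite mulmx0 mxE.
have Qu : Q \in unitmx.
  rewrite -row_free_unit; apply/inj_row_free => v vQ.
  apply/eqP; rewrite -[v]trmxK trmx_eq0; apply/negPn/negP => /Qp.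
  by rewrite trmxK vQ mul0mx mxE ltxx.
pose z i := invmx Q *m delta_mx i 0 : 'cV[R]_m.
exists (\sum_i ((z i)^T *m Q *m z i) 0 0) => [|x]; first exact: sumr_ge0.
rewrite -dotxx /dot mulr_suml; apply: ler_sum => i _.
have zx : ((z i)^T *m Q *m x) 0 0 = x i 0.
  rewrite -[Q in LHS]Qs -trmx_mul /z mulKVmx// trmx_delta -rowE.
  by rewrite !mxE.
by rewrite -expr2 -zx mulrC; apply: quadform_cauchy_schwarz.
Qed.

Lemma quadform_walk (m : nat) (A : I -> 'M[R]_m) (Q : V -> 'M[R]_m) (a : R) :
  0 <= a ->
  (forall v w s, (v, w, s) \in E -> psd (a *: Q v - (A s)^T *m Q w *m A s)) ->
  forall p v, walk E v p -> exists w, forall x : 'cV[R]_m,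
    let y := prodmx A (map (fun e => e.2) p) *m x in
    (y^T *m Q w *m y) 0 0 <= a ^+ size p * (x^T *m Q v *m x) 0 0.
Proof.
move=> a0 lmi; elim=> [|[[v' w] s] p IH] v /=.
  by move=> _; exists v => x; rewrite mul1mx mul1r.
case/and3P => eE /eqP vv /IH[w' w'P]; exists w' => x.
rewrite -[prodmx A _ *m A s *m x]mulmxA.
apply: le_trans (w'P _) _; rewrite exprSr -mulrA ler_wpM2l ?exprn_ge0//.
have [_ /(_ x)] := lmi _ _ _ eE.
by rewrite quadform_lmi subr_ge0 -vv.
Qed.

Lemma cjsr_le_of_lift_lmi (n : nat) (A : I -> 'M[R]_n) (d : nat) (g : R)
    (Q : V -> 'M[R]_#|{: multi_index n d}|) : (1 <= d)%N -> 0 <= g ->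
  (forall v, posdef (Q v)) ->
  (forall v w s, (v, w, s) \in E ->
     psd (g ^+ 2 *: Q v - (liftsys d A s)^T *m Q w *m liftsys d A s)) ->
  cjsr E A <= g `^ (d%:R^-1).
Proof.
move=> d1 g0 Qpos lmi.
pose h := g `^ (d%:R^-1).
have h0 : 0 <= h by exact: powR_ge0.
have hd : h ^+ d = g.
  by rewrite -powR_mulrn// -powRrM mulVf ?pnatr_eq0 -?lt0n// powRr1.
have /choice[kap kapP] : forall v, exists k : R, 0 <= k /\
    forall x : 'cV[R]_#|{: multi_index n d}|, fro2 x <= k * (x^T *m Q v *m x) 0 0.
  by move=> v; have [k k0 kP] := posdef_coercive (Qpos v); exists k.
have Q0 v (x : 'cV[R]_#|{: multi_index n d}|) : 0 <= (x^T *m Q v *m x) 0 0.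
  have [->|x0] := eqVneq x 0; first by rewrite mulmx0 mxE.
  by have [_ Qp] := Qpos v; exact/ltW/Qp.
have [C C0 CP] := fro2_expr_le_liftv R n d.
pose q v j := ((liftv d (delta_mx j 0 : 'cV[R]_n))^T *m Q v *m
                 liftv d (delta_mx j 0 : 'cV[R]_n)) 0 0.
(* Summing over all nodes and basis vectors makes the constant independent of the walk and of the
   column. *)
pose K := C * ((\sum_v kap v) * (\sum_v \sum_j q v j)).
have kap_le v : kap v <= \sum_v kap v.
  rewrite (bigD1 v)//= lerDl sumr_ge0// => w _; exact: (kapP w).1.
have q_le v j : q v j <= \sum_v \sum_j q v j.
  rewrite (bigD1 v)//= (bigD1 j)//= -addrA lerDl addr_ge0//.
    by apply: sumr_ge0 => k _; exact: Q0.
  by apply: sumr_ge0 => w _; apply: sumr_ge0 => k _; exact: Q0.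
have sq0 : 0 <= \sum_v \sum_j q v j.
  by apply: sumr_ge0 => w _; apply: sumr_ge0 => k _; exact: Q0.
have sk0 : 0 <= \sum_v kap v by apply: sumr_ge0 => v _; exact: (kapP v).1.
have K0 : 0 <= K by rewrite !mulr_ge0.
have col_bound v p j : walk E v p ->
    fro2 (col j (prodmx A (map (fun e => e.2) p))) <= (1 + K) * (h ^+ 2) ^+ size p.
  move=> wp; set M := prodmx A _.
  rewrite -(@ler_pXn2r _ d) ?nnegrE ?fro2_ge0 ?mulr_ge0 ?addr_ge0 ?exprn_ge0//.
  have hg : ((h ^+ 2) ^+ size p) ^+ d = (g ^+ 2) ^+ size p.
    by rewrite -hd -!exprM [in RHS]mulnCA [(d * _)%N]mulnC.
  rewrite exprMn hg.
  (* Since [d] is positive, [K <= 1 + K <= (1 + K) ^+ d], which spares a d-th root of [K]. *)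
  apply: (@le_trans _ _ (K * (g ^+ 2) ^+ size p)); last first.
    rewrite ler_wpM2r ?exprn_ge0 ?sqr_ge0//.
    apply: (@le_trans _ _ (1 + K)); first by rewrite lerDr.
    by rewrite -[leLHS]expr1 ler_weXn2l// lerDl.
  rewrite colE; apply: le_trans (CP _) _; rewrite /K -!mulrA ler_wpM2l//.
  rewrite -liftmxP -prodmx_liftsys.
  have [w wP] := quadform_walk (sqr_ge0 g) lmi wp.
  apply: le_trans ((kapP w).2 _) _.
  apply: ler_pM => //; first exact: (kapP w).1.
  apply: le_trans (wP _) _; rewrite mulrC ler_wpM2r ?exprn_ge0 ?sqr_ge0//.
  exact: q_le.
rewrite cjsrE.
apply: (@growth_rate_le_of_bound _ _ (max_norm_ge0 E A) (Num.sqrt (n%:R * (1 + K)))) => //.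
move=> t; apply: bigmax_le => [|s sE].
  by rewrite mulr_ge0 ?sqrtr_ge0 ?exprn_ge0.
have [|v [p [wp sp]]] := accepted_walk sE; first by case: s sE => -[].
have tp : t.+1 = size p by rewrite -(size_tuple s) sp size_map.
rewrite -(@ler_pXn2r _ 2) ?nnegrE ?mxnorm_ge0 ?mulr_ge0 ?sqrtr_ge0 ?exprn_ge0//.
rewrite mxnorm_sqr exprMn sqr_sqrtr ?mulr_ge0 ?addr_ge0//.
rewrite fro2_col_sum sp -mulrA mulr_natl -[X in _ *+ X]card_ord -sumr_const.
apply: ler_sum => j _; apply: le_trans (col_bound v p j wp) _.
by rewrite tp -!exprM mulnC.
Qed.

Lemma lift_lmi_feasible (n : nat) (A : I -> 'M[R]_n) (d : nat) (g c : R) :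
  cjsr E A < g -> 0 < c -> #|{: multi_index n d}|%:R * c < 1 ->
  exists Q : V -> 'M[R]_#|{: multi_index n d}|,
    (forall v, posdef (Q v)) /\
    (forall v w s, (v, w, s) \in E ->
       psd ((g ^+ d / Num.sqrt c) ^+ 2 *: Q v
            - (liftsys d A s)^T *m Q w *m liftsys d A s)).
Proof.
rewrite cjsrE => rho_g c0 mc.
have g0 : 0 < g.
  exact: le_lt_trans (growth_rate_ge0 _) rho_g.
have [C C0 CP] := growth_rate_bound (max_norm_ge0 E A) (max_norm_submul E A) rho_g.
have [K K0 KP] := liftmx_bound R n d.
pose lab (p : seq (V * V * I)) := map (fun e => e.2) p.
(* The second summand accounts for the empty walk, outside the range of [CP]. *)
pose D := C ^+ 2 + fro2 (1%:M : 'M[R]_n).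
have D0 : 0 <= D by rewrite addr_ge0 ?sqr_ge0 ?fro2_ge0.
have walk_bound v p : walk E v p ->
    fro2 (prodmx A (lab p)) <= D * (g ^+ 2) ^+ size p.
  case: p => [|e p] wp; first by rewrite mulr1 lerDr sqr_ge0.
  apply: (@le_trans _ _ (C ^+ 2 * (g ^+ 2) ^+ (size p).+1)); last first.
    by rewrite ler_wpM2r ?(exprn_ge0, ltW g0)// /D lerDl fro2_ge0.
  have := mxnorm_le_max_norm A (walk_accepted wp).
  rewrite size_map -mxnorm_sqr => /le_trans/(_ (CP _)) le.
  rewrite -exprM mulnC exprM -exprMn.
  by rewrite ler_pXn2r ?nnegrE ?mxnorm_ge0 ?mulr_ge0 ?exprn_ge0 ?(ltW g0).
pose gd := g ^+ d.
have gd0 : 0 < gd by rewrite exprn_gt0.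
pose B v (p : {p | walk E v p}) :=
  (gd ^- size (val p)) *: prodmx (liftsys d A) (lab (val p)).
have B_bound v p (x : 'cV[R]_#|{: multi_index n d}|) :
    fro2 (B v p *m x) <= K * D ^+ d * fro2 x.
  apply: le_trans (fro2M _ _) _; rewrite ler_wpM2r ?fro2_ge0//.
  rewrite fro2Z exprVn mulrC ler_pdivrMr ?exprn_gt0// prodmx_liftsys.
  apply: le_trans (KP _) _; rewrite -mulrA ler_wpM2l//.
  have -> : D ^+ d * (gd ^+ size (val p)) ^+ 2 = (D * (g ^+ 2) ^+ size (val p)) ^+ d.
    by rewrite exprMn /gd -!exprM mulnC [(_ * 2)%N]mulnC.
  rewrite lerXn2r ?nnegrE ?fro2_ge0 ?mulr_ge0 ?(exprn_ge0, ltW g0)//.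
  exact: walk_bound (valP p).
have /choice[S SP] : forall v, exists S : 'M[R]_#|{: multi_index n d}|,
    [/\ S \in unitmx,
      forall p (x : 'cV[R]_#|{: multi_index n d}|), fro2 (B v p *m x) <= fro2 (S *m x) &
      forall x : 'cV[R]_#|{: multi_index n d}|,
        exists p, c * fro2 (S *m x) <= fro2 (B v p *m x)].
  move=> v; apply: (@approx_john _ _ _ (B v) (exist (walk E v) [::] erefl) (K * D ^+ d)) => //.
  by rewrite /B /= invr1 scale1r.
exists (fun v => (S v)^T *m S v); split=> [v|v w s vws].
  split=> [|x x0]; first by rewrite trmx_mul trmxK.
  rewrite quadform_tr_mul lt_neqAle fro2_ge0 andbT eq_sym fro2_eq0.
  apply: contra x0 => /eqP Sx; have [Su _ _] := SP v.
  by rewrite -(mulKmx Su x) Sx mulmx0.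
split=> [|x].
  by rewrite linearB linearZ /= !trmx_mul !trmxK !mulmxA.
rewrite quadform_lmi subr_ge0 !quadform_tr_mul.
have [_ _ /(_ (liftsys d A s *m x))[p pP]] := SP w.
rewrite expr_div_n sqr_sqrtr ?(ltW c0)// mulrAC ler_pdivlMr// mulrC.
apply: le_trans pP _.
(* Prefixing the edge turns the nearly extremal walk from [w] into a walk from [v], at the cost of
   one factor [gd]. *)
have wp : walk E v ((v, w, s) :: val p) by rewrite /= vws eqxx (valP p).
have [_ /(_ (exist (walk E v) _ wp) x) le _] := SP v.
rewrite mulrC -ler_pdivrMr ?exprn_gt0//; apply: le_trans le.
rewrite /B /= -!scalemxAl !fro2Z mulmxA.
have -> : gd ^- (size (sval p)).+1 = gd ^- size (sval p) * gd^-1.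
  by rewrite exprS invfM mulrC.
by rewrite exprMn [gd^-1 ^+ 2]exprVn mulrAC.
Qed.

End Main.

Theorem theorem3p6 (R : realType) (V I : finType) (E : {set V * V * I})
  (n : nat) (A : I -> 'M[R]_n) (d : nat) :
  strongly_connected E -> (1 <= d)%N ->
  cjsr E A <= gamma_star E (liftsys d A) `^ (d%:R^-1) /\
  gamma_star E (liftsys d A) `^ (d%:R^-1)
    <= ('C(n + d - 1, d))%:R `^ ((2 * d)%:R^-1) * cjsr E A.
Proof.
move=> _ d1.
have d0 : d%:R != 0 :> R by rewrite pnatr_eq0 -lt0n.
have rho0 : 0 <= cjsr E A.
  by rewrite cjsrE growth_rate_ge0.
rewrite -(multi_index_card n d1); set m := #|_|.
set G := gamma_star _ _; set rho := cjsr E A in rho0 *.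
have lb : has_lbound [set g : R | 0 <= g /\
        exists Q : V -> 'M[R]_m,
          (forall v, posdef (Q v)) /\
          (forall v w s, (v, w, s) \in E ->
             psd (g ^+ 2 *: Q v - (liftsys d A s)^T *m Q w *m liftsys d A s))]%classic.
  by exists 0 => g [].
have G_le g c : rho < g -> 0 < c -> m%:R * c < 1 -> G <= g ^+ d / Num.sqrt c.
  move=> rg c0 mc; apply: ge_inf => //; split; last exact: lift_lmi_feasible.
  by rewrite divr_ge0 ?sqrtr_ge0// exprn_ge0// (le_trans rho0)// ltW.
(* Any admissible [c] will do: it only shows that the set of rates is nonempty, so that its [inf] is
   not a default value. *)
have [c [c0 mc]] : exists c : R, 0 < c /\ m%:R * c < 1.
  exists (m.+1%:R^-1); rewrite invr_gt0 ltr0n; split=> //.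
  by rewrite ltr_pdivrMr ?ltr0n// mul1r ltr_nat.
have rho_le : rho ^+ d <= G.
  apply: lb_le_inf.
    exists ((rho + 1) ^+ d / Num.sqrt c); split; last first.
      by apply: lift_lmi_feasible => //; rewrite ltrDl.
    by rewrite divr_ge0 ?sqrtr_ge0// exprn_ge0// addr_ge0.
  move=> g [g0 [Q [Qp lmi]]].
  have := cjsr_le_of_lift_lmi d1 g0 Qp lmi.
  rewrite -(@ler_pXn2r _ d) ?nnegrE ?powR_ge0//.
  by rewrite -[X in _ <= X -> _]powR_mulrn ?powR_ge0// -powRrM mulVf// powRr1.
have G0 : 0 <= G by apply: le_trans rho_le; exact: exprn_ge0.
have GdX : (G `^ d%:R^-1) ^+ d = G.
  by rewrite -powR_mulrn ?powR_ge0// -powRrM mulVf// powRr1.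
split.
  by rewrite -(@ler_pXn2r _ d) ?nnegrE ?powR_ge0// GdX.
have d20 : (0 < 2 * d)%N by rewrite muln_gt0.
(* [G_le] raised to the power 2, in the limit where the rate [rho + e] decreases to [rho]. *)
have root_le (r : R) : 0 < r -> m%:R * r < 1 -> r * G ^+ 2 <= rho ^+ (2 * d).
  move=> r0 mr; pose y := (r * G ^+ 2) `^ (2 * d)%:R^-1.
  have yX : y ^+ (2 * d) = r * G ^+ 2.
    rewrite -powR_mulrn ?powR_ge0// -powRrM mulVf ?pnatr_eq0 -?lt0n// powRr1//.
    by rewrite mulr_ge0 ?sqr_ge0// ltW.
  rewrite -yX lerXn2r ?nnegrE ?powR_ge0//.
  apply/ler_addgt0Pr => e e0.
  have re0 : 0 <= rho + e by rewrite addr_ge0// ltW.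
  rewrite -(@ler_pXn2r _ (2 * d)) ?nnegrE ?powR_ge0// yX.
  have := G_le (rho + e) r; rewrite ltrDl => /(_ e0 r0 mr).
  rewrite ler_pdivlMr ?sqrtr_gt0// => le.
  rewrite mulnC exprM -[r]sqr_sqrtr ?(ltW r0)// -exprMn.
  by rewrite lerXn2r ?nnegrE ?mulr_ge0 ?sqrtr_ge0 ?exprn_ge0// mulrC.
(* The limit of [r] towards [1 / m], by contradiction. Dividing the excess by [m.+1] keeps [m * e]
   strictly below it and also covers [m = 0]. *)
have sq_le : G ^+ 2 <= m%:R * rho ^+ (2 * d).
  rewrite leNgt; apply/negP; set r := rho ^+ _ => rG.
  have r0 : 0 <= r by rewrite exprn_ge0.
  have G20 : 0 < G ^+ 2 by apply: le_lt_trans rG; rewrite mulr_ge0.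
  pose e := (G ^+ 2 - m%:R * r) / m.+1%:R.
  have e0 : 0 < e by rewrite divr_gt0 ?ltr0n// subr_gt0.
  have me : m%:R * e < G ^+ 2 - m%:R * r.
    rewrite /e mulrCA gtr_pMr ?subr_gt0//.
    by rewrite ltr_pdivrMr ?ltr0n// mul1r ltr_nat.
  have := root_le ((r + e) / G ^+ 2).
  rewrite divfK ?gt_eqF// gerDl leNgt e0 /= => H.
  have : false; last by [].
  apply: H; first by rewrite divr_gt0// ltr_wpDl.
  by rewrite mulrA ltr_pdivrMr// mul1r mulrDr; lra.
rewrite -(@ler_pXn2r _ (2 * d)) ?nnegrE ?mulr_ge0 ?powR_ge0//.
rewrite exprMn mulnC exprM GdX mulnC.
rewrite -[X in X * _]powR_mulrn ?powR_ge0// -powRrM mulVf ?pnatr_eq0 -?lt0n//.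
by rewrite powRr1.
Qed.
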